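(* Let $X$ be the Cantor set. There exists a uniformly discrete piecewise full group $G\le\mathrm{Homeo}(X)$ such that there is no finite group $F<\mathrm{Homeo}(X)$ with $G\leq\mathbf{F}(F)$.
   Context: For $G\le \mathrm{Homeo}(X)$, the piecewise full group $\mathbf{F}(G)$ consists of all $g\in\mathrm{Homeo}(X)$ for which there are a finite clopen partition $X=U_1\sqcup\dots\sqcup U_n$ and $g_1,\dots,g_n\in G$ with $g|_{U_i}=g_i|_{U_i}$; $G$ is piecewise full if $\mathbf{F}(G)=G$. $G$ is uniformly discrete if there is a (finite) clopen partition $\mathcal{P}$ of $X$ with $|Gx\cap U|\le1$ for all $x\in X$ and $U\in\mathcal{P}$. *)

(* Defs.v *)
From HB Require Import structures.
From mathcomp Require Import all_boot.
From mathcomp Require Import boolp classical_sets functions cardinality.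
From mathcomp Require Import topology cantor.

Set Implicit Arguments.
Unset Strict Implicit.
Unset Printing Implicit Defensive.

Local Open Scope classical_set_scope.
Local Open Scope card_scope.

(* The inverse is stored as a function; it is determined by the map, so two   *)
(* homeomorphisms are equal as soon as their maps are (homeoP).               *)
Record homeo (X : topologicalType) := Homeo {
  homeo_fun :> X -> X;
  homeo_inv : X -> X;
  homeo_continuous : continuous homeo_fun;
  homeo_inv_continuous : continuous homeo_inv;
  homeo_funK : cancel homeo_fun homeo_inv;
  homeo_invK : cancel homeo_inv homeo_fun }.

Section HomeoGroup.
Variable X : topologicalType.

Lemma homeoP (g h : homeo X) : (forall x, g x = h x) -> g = h.
Proof.
case: g h => [f f' cf cf' fK f'K] [k k' ck ck' kK k'K] /= fk.
have {}fk : f = k by apply/funext.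
subst k; have ff' : f' = k' by apply/funext => y; rewrite -[y]k'K fK kK.
by subst k'; congr Homeo; exact: Prop_irrelevance.
Qed.

HB.instance Definition _ := gen_eqMixin (homeo X).
HB.instance Definition _ := gen_choiceMixin (homeo X).

Definition homeo_one : homeo X :=
  @Homeo X id id (fun=> cvg_id) (fun=> cvg_id)
    (fun=> erefl) (fun=> erefl).

Definition homeo_invg (g : homeo X) : homeo X :=
  Homeo (@homeo_inv_continuous X g) (@homeo_continuous X g)
    (@homeo_invK X g) (@homeo_funK X g).

Lemma continuous_compT (f g : X -> X) :
  continuous f -> continuous g -> continuous (f \o g).
Proof. by move=> cf cg x; apply: continuous_comp; [exact: cg|exact: cf]. Qed.

(* (g * h) x = g (h x) *)
Definition homeo_mul (g h : homeo X) : homeo X :=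
  Homeo
    (continuous_compT (@homeo_continuous X g) (@homeo_continuous X h))
    (continuous_compT (@homeo_inv_continuous X h) (@homeo_inv_continuous X g))
    (can_comp (@homeo_funK X g) (@homeo_funK X h))
    (can_comp (@homeo_invK X h) (@homeo_invK X g)).

Fact homeo_mulA : associative homeo_mul.
Proof. by move=> f g h; apply: homeoP. Qed.

Fact homeo_mul1g : left_id homeo_one homeo_mul.
Proof. by move=> g; apply: homeoP. Qed.

Fact homeo_mulg1 : right_id homeo_one homeo_mul.
Proof. by move=> g; apply: homeoP. Qed.

Fact homeo_mulVg : left_inverse homeo_one homeo_invg homeo_mul.
Proof. by move=> g; apply: homeoP => x /=; exact: homeo_funK. Qed.

Fact homeo_mulgV : right_inverse homeo_one homeo_invg homeo_mul.
Proof. by move=> g; apply: homeoP => x /=; exact: homeo_invK. Qed.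

HB.instance Definition _ := isGroup.Build (homeo X)
  homeo_mulA homeo_mul1g homeo_mulg1 homeo_mulVg homeo_mulgV.

End HomeoGroup.

Section PiecewiseFull.
Variable X : topologicalType.
Implicit Types G : set (homeo X).

Definition clopen_partition n (U : 'I_n -> set X) :=
  partition [set: 'I_n] U [set: X] /\ forall i, clopen (U i).

Definition full_group G : set (homeo X) :=
  [set g : homeo X | exists n (U : 'I_n -> set X) (h : 'I_n -> homeo X),
     [/\ clopen_partition U,
         forall i, G (h i) &
         forall i, {in U i, g =1 h i}]].

Definition piecewise_full G := full_group G = G.

Definition homeo_orbit G (x : X) : set X := [set g x | g in G].

Definition uniformly_discrete G :=
  exists n (U : 'I_n -> set X),
    clopen_partition U /\
    forall x i, (homeo_orbit G x `&` U i) #<= `I_1.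

End PiecewiseFull.

(* Main.v *)
Require Import Defs.
From mathcomp Require Import all_boot.
From mathcomp Require Import boolp classical_sets functions cardinality.
From mathcomp Require Import topology cantor.
From mathcomp Require Import finmap.
From mathcomp Require Import zify.

(** Let [G] consist of the homeomorphisms preserving every class of an
    equivalence relation whose classes have at most two points, told apart by
    coordinate 0.  Such a [G] is a uniformly discrete group, and it is piecewise
    full because membership is a pointwise condition.  The two-point classes
    come from homeomorphisms between disjoint clopen sets [K_ij] and [L_ij],
    where for every [i], as [j] tends to infinity, [K_ij] shrinks to a point [y]
    independent of [i] while [L_ij] shrinks to a point [w_i].  For every [c],
    exchanging [K_ij] and [L_ij] whenever [i + j + 2 = c] is an element of [G].
    If all these elements were piecewise in a finite set [F], then by pigeonhole
    and continuity every [w_i] would be of the form [f y] with [f] in [F], but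
    the [w_i] are pairwise distinct.  Concretely, [K_ij] and [L_ij] are the
    cylinders of the words 0 0^j 1 0^i 1 and 1 0^i 1 0^j 1, exchanged by
    flipping coordinate 0 and reversing the positions strictly between 0 and
    the second 1 (which is at position [c]). *)

Set Implicit Arguments.
Unset Strict Implicit.
Unset Printing Implicit Defensive.

Local Open Scope classical_set_scope.

Definition rel_homeo (X : topologicalType) (R : X -> X -> Prop) :
  set (homeo X) := [set g : homeo X | forall x, R x (g x)].

Lemma rel_homeo_group (X : topologicalType) (R : X -> X -> Prop) :
  (forall x, R x x) -> (forall x y, R x y -> R y x) ->
  (forall x y z, R x y -> R y z -> R x z) ->
  group_closed [in rel_homeo R].
Proof.
move=> Rxx Rsym Rtr; split; first by apply/mem_set => x; exact: Rxx.
move=> u v /set_mem Ru /set_mem Rv; apply/mem_set => x.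
(* Closure under division: [x] and its image under [u * v^-1] are both related to [v^-1 x]. *)
apply: Rtr (Ru (homeo_inv v x)); apply: Rsym.
by have := Rv (homeo_inv v x); rewrite homeo_invK.
Qed.

Lemma rel_homeo_full (X : topologicalType) (R : X -> X -> Prop) :
  [set: X] !=set0 -> piecewise_full (rel_homeo R).
Proof.
move=> X0; apply/seteqP; split => [g [n [U [h [[[UT _ _] _] Rh gh]]]] x|g Rg].
  have : cover [set: 'I_n] U x by rewrite UT.
  move=> [i _ Uix]; have -> : g x = h i x by apply: gh; exact/mem_set.
  by have := Rh i; apply.
(* A single block suffices; blocks must be nonempty, hence the assumption on [X]. *)
exists 1, (fun=> [set: X]), (fun=> g); split => //; split => //.
- split => //; first by apply/seteqP; split => // x _; exists ord0.
  by move=> i j _ _ _; rewrite !ord1.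
- by move=> i; exact: clopenT.
Qed.

(** The space is a product of copies of the discrete [bool], so each coordinate eventually attains
    its limit. *)
Lemma cantor_cvgP (F : set_system cantor_space) (x : cantor_space) :
  Filter F -> F --> x <-> forall k, \forall y \near F, y k = x k.
Proof.
move=> FF; have -> : F --> x <-> forall k, y k @[y --> F] --> x k.
  exact: (@pointwise_cvgP nat bool).
have P k := discrete_cvg ((fun y : cantor_space => y k) @ F) (x k)
  (fmap_filter _ FF).
by split=> Fx k; apply P; exact: Fx.
Qed.

Lemma eval_continuous k : continuous (fun x : cantor_space => x k).
Proof. exact: (@proj_continuous nat (fun=> bool) k). Qed.

Lemma near_agree_below m (x : cantor_space) :
  \forall y \near x, forall k, k < m -> y k = x k.
Proof.
have : nbhs x [set y : cantor_space | forall k : 'I_m, y k = x k].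
  have := @filter_forall _ _ (fun (k : 'I_m) (y : cantor_space) => y k = x k)
    (nbhs x) (nbhs_filter x).
  by apply => k; apply: (cantor_cvgP _ _).1; exact: cvg_id.
by apply: filterS => y yx k km; exact: yx (Ordinal km).
Qed.

Lemma local_continuous (f : cantor_space -> cantor_space) :
  (forall k, exists m, forall x y : cantor_space,
    (forall l, l < m -> x l = y l) -> f x k = f y k) ->
  continuous f.
Proof.
move=> fP x; apply/cantor_cvgP => k; have [m fm] := fP k.
suff : nbhs x [set y | f y k = f x k] by [].
by apply: filterS (near_agree_below m x) => y /fm.
Qed.

Definition reverse (c : nat) (x : cantor_space) : cantor_space :=
  fun k => if k == 0 then ~~ x 0 else if k < c then x (c - k) else x k.

(** The union of all K_ij and L_ij with [i + j + 2 = c]: coordinate 0 is free, and [a] is [j + 1] on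
    K_ij, [i + 1] on L_ij. *)
Definition two_ones (c : nat) (x : cantor_space) : Prop :=
  exists2 a, 0 < a < c & forall k, 0 < k <= c -> x k = (k == a) || (k == c).

Lemma reverseK c : involutive (reverse c).
Proof.
move=> x; apply/funext => k; rewrite /reverse /=.
have [->|k0] := eqVneq k 0; first by rewrite negbK.
have [kc|//] := ltnP k c.
have -> : (c - k == 0) = false by lia.
by have -> : c - k < c by [lia]; rewrite subKn // ltnW.
Qed.

Lemma two_ones_reverse c x : two_ones c x -> two_ones c (reverse c x).
Proof.
move=> [a ac xa]; exists (c - a) => [|k k0c]; first lia.
rewrite /reverse; have -> : (k == 0) = false by lia.
by have [kc|kc] := ltnP k c; rewrite xa; lia.
Qed.

(** [c] is the position of the second 1 past coordinate 0. This makes [paired] transitive. *)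
Lemma two_ones_inj c d x : two_ones c x -> two_ones d x -> c = d.
Proof.
wlog cd : c d / c <= d.
  move=> W xc xd; have [cd|/ltnW dc] := leqP c d; first exact: W.
  by apply/esym; exact: W.
move=> [a ac xa] [b bd xb]; apply/eqP; rewrite eqn_leq cd /= leqNgt.
apply/negP => ltcd.
have : x a by rewrite xa ?eqxx//; lia.
have : x c by rewrite xa ?eqxx ?orbT//; lia.
by rewrite !xb; lia.
Qed.

Definition paired (x y : cantor_space) : Prop :=
  x = y \/ exists2 c, two_ones c x & y = reverse c x.

Lemma paired_refl x : paired x x. Proof. by left. Qed.

Lemma paired_sym x y : paired x y -> paired y x.
Proof.
move=> [->|[c cx ->]]; first by left.
by right; exists c; [exact: two_ones_reverse|rewrite reverseK].
Qed.

Lemma paired_trans x y z : paired x y -> paired y z -> paired x z.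
Proof.
move=> [->//|[c cx ->]] [<-|[d dx ->]]; first by right; exists c.
have -> : d = c by exact: two_ones_inj dx (two_ones_reverse cx).
by left; rewrite reverseK.
Qed.

Lemma paired_inj x y : paired x y -> x 0 = y 0 -> x = y.
Proof. by move=> [//|[c _ ->]]; rewrite /reverse /=; case: (x 0). Qed.

Definition exchange (c : nat) (x : cantor_space) : cantor_space :=
  if `[< two_ones c x >] then reverse c x else x.

Lemma exchangeK c : involutive (exchange c).
Proof.
move=> x; rewrite {2}/exchange; case: asboolP => xc; last first.
  by rewrite /exchange; case: asboolP.
by rewrite /exchange asboolT ?reverseK//; exact: two_ones_reverse.
Qed.

Lemma exchange_continuous c : continuous (exchange c).
Proof.
(* [two_ones c] reads coordinates up to [c]; [reverse c] reads only 0, [c - k] or [k]. *)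
apply: local_continuous => k; exists (maxn k c).+1 => x y xy.
have -> : exchange c y k = (if `[< two_ones c x >] then reverse c y else y) k.
  rewrite /exchange; congr ((if _ then _ else _) _); apply: asbool_equiv_eq.
  by split=> -[a ac ya]; exists a => // l lc; rewrite -ya// xy//; lia.
rewrite /exchange; case: ifP => _; last by rewrite xy//; lia.
rewrite /reverse; case: eqP => [_|_]; first by rewrite xy.
by case: ltnP => kc; rewrite xy//; lia.
Qed.

Definition exchange_homeo (c : nat) : homeo cantor_space :=
  Homeo (@exchange_continuous c) (@exchange_continuous c)
    (@exchangeK c) (@exchangeK c).

Lemma exchange_paired c : rel_homeo paired (exchange_homeo c).
Proof.
move=> x /=; rewrite /exchange; case: asboolP => xc; last by left.
by right; exists c.
Qed.

Lemma card_le_I1 (T : Type) (A : set T) : is_subset1 A -> (A #<= `I_1)%card.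
Proof.
move=> A1; have [->|/set0P[a Aa]] := eqVneq A set0; first exact: card_ge0.
have /subset_card_le /card_le_trans : A `<=` [set a] by move=> b Ab; exact: A1.
by apply; have /card_eqPle[] := @card_set1 T a.
Qed.

Lemma paired_uniformly_discrete : uniformly_discrete (rel_homeo paired).
Proof.
exists 2, (fun i => [set x : cantor_space | x 0 = (i == ord0)]); split.
  split; last first.
    move=> i; have := @preimage_clopen _ _ (fun x : cantor_space => x 0)
      [set i == ord0]; apply; last exact: eval_continuous.
    by split; [exact: discrete_open|exact: discrete_closed].
  split.
  - apply/seteqP; split => // x _.
    exists (if x 0 then ord0 else ord_max) => //=.
    by case: (x 0).
  - move=> i j _ _ [x [/= -> ]].
    by case: i j => [[|[|//]] ?] [[|[|//]] ?] //= _; exact: val_inj.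
  - by move=> i _; exists (fun=> i == ord0).
move=> x i; apply: card_le_I1 => _ _ [[g Gg <-] gx] [[h Gh <-] hx].
apply: paired_inj; last by rewrite gx hx.
exact: paired_trans (paired_sym (Gg x)) (Gh x).
Qed.

(** The point of K_ij with no further 1s. *)
Definition lone_pair (i j : nat) : cantor_space :=
  fun k => (k == j.+1) || (k == i.+1 + j.+1).

Definition origin : cantor_space := fun=> false.

(** The point w_i; [origin] is y. *)
Definition limit_point (i : nat) : cantor_space :=
  fun k => (k == 0) || (k == i.+1).

Lemma limit_point_inj : injective limit_point.
Proof.
move=> i j /(congr1 (fun x : cantor_space => x i.+1)).
by rewrite /limit_point eqxx /= => /esym/eqP[].
Qed.

Lemma two_ones_lone_pair i j : two_ones (i.+1 + j.+1) (lone_pair i j).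
Proof. by exists j.+1; first lia. Qed.

Lemma lone_pair_cvg i : lone_pair i j @[j --> \oo] --> origin.
Proof.
apply/cantor_cvgP => k; exists k => // j /= kj.
by apply/negbTE; rewrite /lone_pair; lia.
Qed.

Lemma reverse_lone_pair_cvg i :
  reverse (i.+1 + j.+1) (lone_pair i j) @[j --> \oo] --> limit_point i.
Proof.
apply/cantor_cvgP => k; exists k => // j /= kj.
rewrite /reverse /lone_pair /limit_point.
have [->//|k0] := eqVneq k 0; case: ltnP => ?; case: eqP; lia.
Qed.

(** If no [f] in [F] sent [origin] to [limit_point i], then by continuity each would fail, for all
    large [j], to send [lone_pair i j] to its partner; as [F] is finite, some [j] defeats all of
    them. *)
Lemma finite_full_limit (F : set (homeo cantor_space)) (i : nat) :
  finite_set F -> rel_homeo paired `<=` full_group F ->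
  exists2 f, F f & f origin = limit_point i.
Proof.
move=> Ffin GF; apply: contrapT => noF.
have : \forall j \near \oo, forall f : homeo cantor_space, F f ->
    f (lone_pair i j) <> reverse (i.+1 + j.+1) (lone_pair i j).
  have : \forall j \near \oo, (\bigcap_(f in [set` fset_set F])
      [set j | f (lone_pair i j) <>
               reverse (i.+1 + j.+1) (lone_pair i j)]) j.
    apply: filter_bigI => f; rewrite in_fset_set// => /set_mem Ff.
    have [k fk] : exists k, f origin k <> limit_point i k.
      apply: contrapT => /forallNP fi; apply: noF; exists f => //.
      by apply/funext => k; exact: contrapT (fi k).
    have fcvg : f (lone_pair i j) @[j --> \oo] --> f origin.
      apply: (cvg_comp _ _ (@lone_pair_cvg i)).
      exact: (@homeo_continuous _ f origin).
    have fnear : \forall j \near \oo, f (lone_pair i j) k = f origin k.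
      exact: (cantor_cvgP _ _).1 fcvg k.
    have rnear : \forall j \near \oo,
        reverse (i.+1 + j.+1) (lone_pair i j) k = limit_point i k.
      exact: (cantor_cvgP _ _).1 (@reverse_lone_pair_cvg i) k.
    apply: filterS2 fnear rnear => j fj rj /= E.
    by apply: fk; rewrite -fj -rj E.
  apply: filterS => j Hj f Ff; apply: Hj.
  by rewrite /= in_fset_set//; exact/mem_set.
move=> [j _ /(_ j (leqnn j)) Hj].
(* On the block containing [lone_pair i j], the exchange agrees with a member of [F]. *)
have [n [U [h [[[UT _ _] _] Fh gh]]]] := GF _ (exchange_paired (i.+1 + j.+1)).
have [l _ Ul] : cover [set: 'I_n] U (lone_pair i j) by rewrite UT.
apply: (Hj (h l)) => //; rewrite -gh /=; last exact/mem_set.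
by rewrite /exchange asboolT//; exact: two_ones_lone_pair.
Qed.

Theorem mainTheorem9 :
  exists G : set (homeo cantor_space),
    [/\ group_closed [in G],
        uniformly_discrete G,
        piecewise_full G &
        ~ exists F : set (homeo cantor_space),
            [/\ group_closed [in F], finite_set F & G `<=` full_group F]].
Proof.
exists (rel_homeo paired); split.
- exact: rel_homeo_group paired_refl paired_sym paired_trans.
- exact: paired_uniformly_discrete.
- by apply: rel_homeo_full; exists origin.
move=> [F [_ Ffin GF]]; apply: infinite_nat.
(* An injection would place all of [nat] in the finite set of images of [origin]. *)
have -> : setT =
    limit_point @^-1` [set (f : homeo cantor_space) origin | f in F].
  by apply/seteqP; split => // i _; exact: finite_full_limit.
apply: finite_preimage; last exact: finite_image.
by move=> i j _ _; exact: limit_point_inj.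
Qed.
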